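(* Let $n, p, q \geq 1$ be integers, let $\Omega$ be a nonempty open subset of $\mathbb{R}^n$, and let $\phi : \Omega \to \mathbb{R}$, $g_i : \Omega \to \mathbb{R}$ ($i \in \{1,\dots,p\}$) and $h_j : \Omega \to \mathbb{R}$ ($j \in \{1,\dots,q\}$) be functions. Let $\hat{x}$ be a solution of the problem $$(\mathcal{M})\quad \text{Maximize } \phi(x) \text{ when } x \in \Omega,\ g_i(x) \geq 0 \text{ for all } i \in \{1,\dots,p\},\ \text{and } h_j(x) = 0 \text{ for all } j \in \{1,\dots,q\}.$$ Assume that: (i) $\phi$ is Fréchet-differentiable at $\hat{x}$; (ii) for all $i \in \{1,\dots,p\}$, $g_i$ is Fréchet-differentiable at $\hat{x}$ when $g_i(\hat{x}) = 0$; (iii) for all $i \in \{1,\dots,p\}$, $g_i$ is lower semicontinuous at $\hat{x}$ and Gâteaux-differentiable at $\hat{x}$ when $g_i(\hat{x}) > 0$; (iv) for all $j \in \{1,\dots,q\}$, $h_j$ is continuous on a neighborhood of $\hat{x}$ and Fréchet-differentiable at $\hat{x}$. Then there exist $\lambda^0, \lambda^1, \dots, \lambda^p \in \mathbb{R}_+$ and $\mu^1, \dots, \mu^q \in \mathbb{R}$ such that the following conditions are satisfied: (a) $(\lambda^0, \lambda^1, \dots, \lambda^p, \mu^1, \dots, \mu^q) \neq (0, 0, \dots, 0)$; (b) for all $i \in \{1,\dots,p\}$, $\lambda^i g_i(\hat{x}) = 0$; (c) $\lambda^0 D\phi(\hat{x}) + \sum_{1 \leq i \leq p} \lambda^i D_G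 g_i(\hat{x}) + \sum_{1 \leq j \leq q} \mu^j D h_j(\hat{x}) = 0$. Moreover, under the additional assumption (v) $Dh_1(\hat{x}), \dots, Dh_q(\hat{x})$ are linearly independent, the multipliers satisfying (a), (b), (c) can be taken such that (d) $(\lambda^0, \lambda^1, \dots, \lambda^p) \neq (0, 0, \dots, 0)$. Furthermore, under (v) and the additional assumption (vi) there exists $w \in \bigcap_{1 \leq j \leq q} \operatorname{Ker} Dh_j(\hat{x})$ such that, for all $i \in \{1,\dots,p\}$, $Dg_i(\hat{x}).w > 0$ when $g_i(\hat{x}) = 0$, the multipliers satisfying (a), (b), (c) can be taken such that (e) $\lambda^0 = 1$.
   Context: $\mathbb{R}_+$ denotes the set of non-negative real numbers. A solution of $(\mathcal{M})$ is a point $\hat{x} \in \Omega$ satisfying all the constraints ($g_i(\hat{x}) \geq 0$ for all $i$, $h_j(\hat{x}) = 0$ for all $j$) and such that $\phi(x) \leq \phi(\hat{x})$ for every $x \in \Omega$ satisfying all the constraints. For $f : \Omega \to \mathbb{R}$, $x \in \Omega$ and $v \in \mathbb{R}^n$, the directional derivative of $f$ at $x$ in the direction $v$ is, when it exists, $\vec{D} f(x;v) := \frac{d}{dt}\big|_{t=0} f(x+tv)$. The function $f$ is Gâteaux-differentiable at $x$ when $\vec{D} f(x;v)$ exists for all $v \in \mathbb{R}^n$ and $v \mapsto \vec{D} f(x;v)$ is linear (and continuous); its Gâteaux-differential at $x$ is the linear form $D_G f(x)$ on $\mathbb{R}^n$ defined by $D_G f(x).v := \vec{D} f(x;v)$.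 $Df(x)$ denotes the usual Fréchet-differential of $f$ at $x$, a linear form on $\mathbb{R}^n$; when $f$ is Fréchet-differentiable at $x$, it is Gâteaux-differentiable at $x$ and $D_G f(x) = Df(x)$. Lower semicontinuity at a point is the classical notion. *)

(* Defs.v *)
From HB Require Import structures.
From mathcomp Require Import all_boot all_order all_algebra.
From mathcomp Require Import all_classical all_reals all_analysis.

Set Implicit Arguments.
Unset Strict Implicit.
Unset Printing Implicit Defensive.

Import Order.TTheory GRing.Theory Num.Theory.
Import numFieldNormedType.Exports.

Local Open Scope classical_set_scope.
Local Open Scope ring_scope.

(* The objective and the constraints are total functions on 'rV[R]_n.  Only
   their values on the open set Omega matter: the maximization is over Omega,
   and continuity, semicontinuity and differentiability at a point of Omega
   are local.  The norm of 'rV[R]_n is the sup norm, which is equivalent to the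
   Euclidean one. *)

Definition feasible (R : realType) (n p q : nat) (Omega : set 'rV[R]_n)
    (g : 'I_p -> 'rV[R]_n -> R) (h : 'I_q -> 'rV[R]_n -> R) : set 'rV[R]_n :=
  [set x | [/\ Omega x, forall i, 0 <= g i x & forall j, h j x = 0]].

Definition is_solution (R : realType) (n p q : nat) (Omega : set 'rV[R]_n)
    (phi : 'rV[R]_n -> R) (g : 'I_p -> 'rV[R]_n -> R)
    (h : 'I_q -> 'rV[R]_n -> R) (xhat : 'rV[R]_n) : Prop :=
  feasible Omega g h xhat /\
  forall x, feasible Omega g h x -> phi x <= phi xhat.

(* Pointwise version of [lower_semicontinuous], for real-valued functions. *)
Definition lower_semicontinuous_at (R : realType) (T : topologicalType)
    (f : T -> R) (x : T) : Prop :=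
  forall a : R, a < f x -> \forall y \near x, a < f y.

Definition gateaux_diff (R : realType) (V : normedModType R) (f : V -> R)
    (x : V) : V -> R :=
  fun v => 'D_v f x.

Definition gateaux_differentiable (R : realType) (V : normedModType R)
    (f : V -> R) (x : V) : Prop :=
  [/\ forall v, derivable f x v,
      linear (gateaux_diff f x : V -> R^o)
    & continuous (gateaux_diff f x)].

(* The differentials of the h j at x, as a family of vectors of the space of
   linear forms on 'rV[R]_n. *)
Definition diff_family (R : realType) (n q : nat) (h : 'I_q -> 'rV[R]_n -> R)
    (x : 'rV[R]_n) : q.-tuple 'Hom('rV[R]_n, R^o) :=
  [tuple linfun ('d (h j : 'rV[R]_n -> R^o) x) | j < q].

Definition FJ_multipliers (R : realType) (n p q : nat)
    (phi : 'rV[R]_n -> R) (g : 'I_p -> 'rV[R]_n -> R)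
    (h : 'I_q -> 'rV[R]_n -> R) (xhat : 'rV[R]_n)
    (lambda0 : R) (lambda : 'I_p -> R) (mu : 'I_q -> R) : Prop :=
  [/\ 0 <= lambda0 /\ (forall i, 0 <= lambda i),
      ~ [/\ lambda0 = 0, forall i, lambda i = 0 & forall j, mu j = 0],
      forall i, lambda i * g i xhat = 0
    & forall v : 'rV[R]_n,
        lambda0 * 'd phi xhat v
        + \sum_(i < p) lambda i * gateaux_diff (g i) xhat v
        + \sum_(j < q) mu j * 'd (h j) xhat v = 0].

(* Main.v *)
Require Import Defs.
From HB Require Import structures.
From mathcomp Require Import all_boot all_order all_algebra all_fingroup.
From mathcomp Require Import all_classical all_reals all_analysis.
From mathcomp Require Import zify ring lra.

(** Suppose first that the differentials of the [h j] at the solution are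
    linearly dependent: a nontrivial relation between them is already a
    multiplier, with all the [lambda]s equal to 0.

    Suppose now that they are independent.  The heart of the proof is that no
    direction [v] in the common kernel of these differentials can strictly
    increase, to first order, [phi] and every active [g i]
    ([no_ascent_direction]).  Such an increase persists for all directions
    close to [v] and all small steps [t], and so do membership in [Omega] and
    positivity of the inactive constraints, for which lower semicontinuity is
    enough; so it contradicts maximality as soon as the zero set of [h] meets
    the points [xhat + t *: v'] with [v'] close to [v].  Gordan's alternative
    ([gordan]), applied to the differentials composed with a projection onto
    the common kernel, turns the absence of such a [v] into nonnegative
    coefficients whose combination vanishes on that kernel, hence is a
    combination of the differentials of the [h j].  When some [w] in the
    kernel strictly increases all the active [g i] to first order, evaluating
    the relation at [w] excludes [lambda0 = 0], and one rescales.

    That the zero set of [h] is tangent to the kernel ([zero_set_tangent])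
    cannot be obtained from the implicit function theorem, since [h] is merely
    continuous near [xhat] and differentiable at [xhat].  Given a right inverse
    [L] of the differential, one looks for a small [w] such that
    [h (xhat + t *: (v + w *m L)) = 0]; divided by [t], the left-hand side is,
    on a fixed ball and for small [t], a continuous perturbation of the
    identity in [w], and a form of Brouwer's theorem provides a zero
    ([near_identity_zero]).

    This form of Brouwer's theorem is derived from a Sperner lemma on a discrete
    torus. There the simplices of the Freudenthal triangulation of a grid form a
    closed pseudomanifold, so that the number of simplices carrying all the
    labels is even ([sum_det_label_mx]): counted over the field with two
    elements, it is a sum of contributions of facets, and each facet lies in two
    simplices. A labelling by signs of coordinates has exactly one full simplex
    away from the seam of the torus; a labelling that agrees with it on the seam
    therefore has an odd number of them there ([cubical_sperner]). No induction
    on the dimension is involved. *)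

Set Implicit Arguments.
Unset Strict Implicit.
Unset Printing Implicit Defensive.

Import Order.TTheory GRing.Theory Num.Theory.
Import numFieldNormedType.Exports.

Local Open Scope classical_set_scope.
Local Open Scope ring_scope.

(** * Sperner's lemma on a finite abelian group *)

(** Adding all the other columns to column [j] turns it into a column of ones;
    expanding along it is the claim.  For the matrix that records which vertex
    of a simplex carries which label, this is the count of the full simplices
    by their facets. *)
Lemma det_sum_cofactor (R : comNzRingType) n (A : 'M[R]_n) (j : 'I_n) :
  (forall i, \sum_c A i c = 1) -> \det A = \sum_i cofactor A i j.
Proof.
move=> A1; set u : 'cV[R]_n := const_mx 1.
have Au : A *m u = u.
  apply/colP => i; rewrite !mxE -[RHS](A1 i).
  by apply: eq_bigr => c _; rewrite mxE mulr1.
have : \adj A *m (A *m u) = \det A *: u.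
  by rewrite mulmxA mul_adj_mx mul_scalar_mx.
rewrite Au => /colP/(_ j); rewrite !mxE mulr1 => <-.
by apply: eq_bigr => i _; rewrite !mxE mulr1.
Qed.

Lemma addrr_F2 (x : 'F_2) : x + x = 0.
Proof. by rewrite -mulr2n -mulr_natl (pchar_Fp_0 (isT : prime 2)) mul0r. Qed.

Lemma oppr_F2 (x : 'F_2) : - x = x.
Proof. by apply/esym/eqP; rewrite -addr_eq0 addrr_F2. Qed.

(** Translation by an odd permutation exchanges even and odd permutations. *)
Lemma sum_perm_F2_0 n (t : 'S_n) (F : 'S_n -> 'F_2) :
  odd_perm t -> (forall s, F (t * s)%g = F s) -> \sum_s F s = 0.
Proof.
move=> todd FE; rewrite (bigID (@odd_perm _)) /=.
rewrite (reindex_inj (mulgI t)) /=.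
rewrite (eq_big (fun s : 'S_n => ~~ odd_perm s) F); first exact: addrr_F2.
  by move=> s; rewrite odd_permM todd.
by move=> s _; rewrite FE.
Qed.

Section Torus.
Variables (A : finZmodType) (m : nat) (e : 'I_m.+1 -> A).
Variable (lab : A -> 'I_m.+2).

(** The vertices of the Freudenthal simplex with origin [b] and order of steps
    [s]: the steps [e (s 0)], [e (s 1)], etc. are added one after the other. *)
Definition vertex (b : A) (s : 'S_m.+1) (k : nat) : A :=
  b + \sum_(i < m.+1 | (i < k)%N) e (s i).

(** Its determinant is 1 when the vertices carry all the labels, and 0
    otherwise: a simplex that is not full has a zero column. *)
Definition label_mx (b : A) (s : 'S_m.+1) : 'M['F_2]_m.+2 :=
  \matrix_(k, c) (lab (vertex b s k) == c)%:R.

Definition rotation : 'S_m.+1 := perm (can_inj (@ordSK m.+1)).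

(** The facet opposite to the first vertex is also the facet opposite to the
    last vertex of the simplex that starts one step later and takes the first
    step last. *)
Lemma vertex_rotation b (s : 'S_m.+1) k : (k <= m)%N ->
  vertex (b + e (s ord0)) (rotation * s)%g k = vertex b s k.+1.
Proof.
move=> km; rewrite /vertex -addrA; congr (_ + _).
rewrite [LHS]addrC [in LHS]big_mkcond [in RHS]big_mkcond.
rewrite [in RHS]big_ord_recl [in LHS]big_ord_recr /=.
rewrite ltnNge km addr0 addrC; congr (_ + _).
apply: eq_bigr => i _; rewrite permM permE /bump /= add1n ltnS.
congr (if _ then _ else _).
congr (e (s _)); apply/val_inj.
by rewrite /= modn_small ?lift0 // ltnS.
Qed.

(** Exchanging two consecutive steps only moves the vertex between them. *)
Lemma vertex_swap b (s : 'S_m.+1) (i : nat) (im : (i.+1 < m.+1)%N) k :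
  k <> i.+1 ->
  vertex b (tperm (Ordinal (ltnW im)) (Ordinal im) * s)%g k = vertex b s k.
Proof.
move=> ki; rewrite /vertex; congr (_ + _).
rewrite (reindex_inj (@perm_inj _ (tperm (Ordinal (ltnW im)) (Ordinal im)))) /=.
apply: eq_big => [j|j _]; last by rewrite permM tpermK.
case: tpermP => [->|->|] //=; lia.
Qed.

(** Like [label_mx], this detects whether the facet opposite to vertex [i]
    carries all the labels but the last. *)
Definition facet_det b s (i : 'I_m.+2) : 'F_2 :=
  \det (row' i (col' ord_max (label_mx b s))).

Lemma facet_det_eq b s i b' s' i' :
  (forall k, vertex b s (lift i k) = vertex b' s' (lift i' k)) ->
  facet_det b s i = facet_det b' s' i'.
Proof.
by move=> E; congr (\det _); apply/matrixP => k c; rewrite !mxE E.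
Qed.

Lemma facet_det_rotation b (s : 'S_m.+1) :
  facet_det (b + e (s ord0)) (rotation * s)%g ord_max = facet_det b s ord0.
Proof.
apply: facet_det_eq => k; rewrite lift0 lift_max.
by apply: vertex_rotation; rewrite -ltnS.
Qed.

(** Each facet is counted twice: facets opposite to an intermediate vertex are
    paired by [vertex_swap], the first and the last ones by
    [vertex_rotation]. *)
Lemma sum_facet_det : \sum_i \sum_b \sum_s facet_det b s i = 0.
Proof.
rewrite big_ord_recl big_ord_recr /=.
rewrite [X in _ + (X + _)]big1 ?add0r => [|i _]; last first.
  apply: big1 => b _.
  pose i1 : (i.+1 < m.+1)%N := ltn_ord i.
  apply: (sum_perm_F2_0 (t := tperm (Ordinal (ltnW i1)) (Ordinal i1))).
    by rewrite odd_tperm -val_eqE /= ltn_eqF.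
  move=> s; apply: facet_det_eq => k; apply: vertex_swap.
  have /eqP := neq_lift (lift ord0 (widen_ord (leqnSn m) i)) k.
  by move=> + E; apply; apply: val_inj; rewrite [RHS]E.
rewrite (_ : lift ord0 ord_max = ord_max); last exact/val_inj.
suff -> : \sum_b \sum_s facet_det b s ord_max =
          \sum_b \sum_s facet_det b s ord0 by exact: addrr_F2.
rewrite exchange_big (reindex_inj (mulgI rotation)) [RHS]exchange_big.
apply: eq_bigr => s _; rewrite (reindex_inj (addIr (e (s ord0)))) /=.
by apply: eq_bigr => b _; rewrite facet_det_rotation.
Qed.

Lemma sum_det_label_mx : \sum_b \sum_s \det (label_mx b s) = 0.
Proof.
rewrite -[RHS]sum_facet_det [RHS]exchange_big; apply: eq_bigr => b _.
rewrite [RHS]exchange_big; apply: eq_bigr => s _.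
rewrite (det_sum_cofactor ord_max) => [|i]; last first.
  rewrite (bigD1 (lab (vertex b s i))) //= mxE eqxx big1 ?addr0 // => c ci.
  by rewrite mxE eq_sym (negPf ci).
apply: eq_bigr => i _; rewrite /cofactor -[RHS]mul1r; congr (_ * _).
by rewrite -signr_odd; case: odd; rewrite ?expr1 ?oppr_F2.
Qed.

Lemma label_mx_full b s : \det (label_mx b s) != 0 ->
  forall c, exists k : 'I_m.+2, lab (vertex b s k) = c.
Proof.
move=> d0 c.
have [/existsP[k /eqP kc]|/existsPn nc] :=
  boolP [exists k : 'I_m.+2, lab (vertex b s k) == c].
  by exists k.
case/eqP: d0; rewrite (expand_det_col _ c) big1 // => k _.
by rewrite mxE (negPf (nc k)) mul0r.
Qed.

End Torus.

(** * The least index satisfying a predicate *)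

(** The value [ord_max] encodes that the predicate holds nowhere. *)
Definition first_true n (P : pred 'I_n) : 'I_n.+1 := inord (find P (enum 'I_n)).

Lemma first_trueE n (P : pred 'I_n) :
  first_true P = find P (enum 'I_n) :> nat.
Proof. by rewrite inordK // ltnS -[leqRHS](size_enum_ord n) find_size. Qed.

Lemma before_first_true n (P : pred 'I_n) (j : 'I_n) :
  (j < first_true P)%N -> ~~ P j.
Proof.
by rewrite first_trueE => /(before_find j); rewrite nth_ord_enum => ->.
Qed.

Lemma at_first_true n (P : pred 'I_n) (j : 'I_n) :
  j = first_true P :> nat -> P j.
Proof.
rewrite first_trueE => jE; have : has P (enum 'I_n).
  by rewrite has_find -jE size_enum_ord.
by move/(nth_find j); rewrite -jE nth_ord_enum.
Qed.

Lemma first_true_mono n (P Q : pred 'I_n) :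
  (forall j, Q j -> P j) -> (first_true P <= first_true Q)%N.
Proof.
move=> QP; rewrite leqNgt; apply/negP => lt.
have Qn : (first_true Q < n)%N by rewrite (leq_trans lt) // -ltnS.
have := @before_first_true _ P (Ordinal Qn) lt.
by rewrite QP // at_first_true.
Qed.

Lemma first_true_unique n (P : pred 'I_n) (k : 'I_n.+1) :
  (forall j : 'I_n, (j < k)%N -> ~~ P j) ->
  (forall j : 'I_n, j = k :> nat -> P j) -> first_true P = k.
Proof.
move=> lt eq; apply/val_inj => /=; case: (ltngtP (first_true P) k) => // h.
- have Pn : (first_true P < n)%N by rewrite (leq_trans h) // -ltnS.
  by have := lt (Ordinal Pn) h; rewrite at_first_true.
- have kn : (k < n)%N by rewrite (leq_trans h) // -ltnS.
  by have := @before_first_true _ P (Ordinal kn) h; rewrite eq.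
Qed.

Lemma leq_homo_ltn_ord n (f : 'I_n -> 'I_n) :
  (forall i j : 'I_n, (i < j)%N -> (f i < f j)%N) ->
  forall i : 'I_n, (i <= f i)%N.
Proof.
move=> fh [i i_n]; elim: i i_n => //= i IH i_n.
rewrite (leq_ltn_trans (IH (ltnW i_n))) //.
exact: (fh (Ordinal (ltnW i_n)) (Ordinal i_n)).
Qed.

Lemma homo_surj_ord_id n (f : 'I_n -> 'I_n) :
  (forall i j : 'I_n, (i <= j)%N -> (f i <= f j)%N) ->
  (forall c, exists k, f k = c) -> forall k, f k = k.
Proof.
move=> fh fs.
have [g gK] := fin_all_exists fs.
have f_inj : injective f := can_inj (canF_sym gK).
have fS (i j : 'I_n) : (i < j)%N -> (f i < f j)%N.
  move=> ij; rewrite ltn_neqAle fh ?(ltnW ij) //.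
  by rewrite (inj_eq val_inj) (inj_eq f_inj) neq_ltn ij.
move=> k; apply/val_inj/eqP; rewrite /= eqn_leq (leq_homo_ltn_ord fS) andbT.
have := @leq_homo_ltn_ord _ (fun i => rev_ord (f (rev_ord i))) _ (rev_ord k).
rewrite rev_ordK /= => rf.
have {}rf : (n - k.+1 <= n - (f k).+1)%N.
  apply: rf => i j ij /=; have := fS (rev_ord j) (rev_ord i).
  have := ltn_ord (f (rev_ord i)); have := ltn_ord j; rewrite /=; lia.
by have := ltn_ord (f k); have := ltn_ord k; lia.
Qed.

(** * Sperner's lemma on a cubical grid *)

Section Grid.
Variables (m N : nat).
Local Notation pt := 'rV['I_N.+2]_m.+1.
Implicit Types (b x : pt) (s : 'S_m.+1).

(** Grid points are taken modulo [N.+2]; the grid is the torus cut open along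
    the seam between the coordinates [N.+1] and [0]. *)
Definition step (j : 'I_m.+1) : pt := delta_mx ord0 j.

Lemma vertex_step b s k j :
  (vertex step b s k : pt) ord0 j = b ord0 j + ((s^-1%g j < k)%N)%:R.
Proof.
rewrite mxE summxE; congr (_ + _).
rewrite big_mkcond (bigD1 (s^-1%g j)) //= permKV mxE !eqxx.
rewrite big1 ?addr0 => [|i ij]; first by case: ifP.
rewrite -(inj_eq (@perm_inj _ s)) permKV in ij.
by case: ifP => // _; rewrite mxE eq_sym (negPf ij).
Qed.

(** A simplex whose origin has no coordinate [N.+1] does not cross the seam, and
    its coordinates can be computed in [nat].  By [vertex_step_outer], a simplex
    that crosses the seam has all its vertices on it. *)
Lemma vertex_step_inner b s k j : (b ord0 j <= N)%N ->
  (vertex step b s k : pt) ord0 j = (b ord0 j + (s^-1%g j < k))%N :> nat.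
Proof.
move=> bN; rewrite vertex_step; case: (_ < k)%N; rewrite ?addr0 ?addn0 //=.
by rewrite !modn_small // ltnS addn1 ltnS.
Qed.

Lemma vertex_step_outer b s k j : ~~ (b ord0 j <= N)%N ->
  (vertex step b s k : pt) ord0 j = N.+1 :> nat \/
  (vertex step b s k : pt) ord0 j = 0 :> nat.
Proof.
move=> bN; have bE : b ord0 j = N.+1 :> nat by have := ltn_ord (b ord0 j); lia.
rewrite vertex_step; case: (_ < k)%N; [right|left]; rewrite ?addr0 //=.
by rewrite bE (modn_small (_ : 1 < N.+2)%N) // addn1 modnn.
Qed.

(** The sign pattern of the identity map, centered at the grid point with all
    coordinates [c]. *)
Definition below c x : pred 'I_m.+1 := fun j => (x ord0 j < c)%N.

Definition sign_label (neg : pt -> pred 'I_m.+1) x := first_true (neg x).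

(** Along a simplex the coordinates increase, hence so does the label.  If all
    the labels occur, vertex [k] has label [k], so that coordinate [k] stops
    being below [c] exactly at step [k]. *)
Lemma below_full_unique c b s : (forall j, b ord0 j <= N)%N ->
  (forall l, exists k : 'I_m.+2,
     sign_label (below c) (vertex step b s k) = l) ->
  s = 1%g /\ forall j, (b ord0 j).+1 = c.
Proof.
move=> bN full.
have lab_id (k : 'I_m.+2) : sign_label (below c) (vertex step b s k) = k.
  pose f (k : 'I_m.+2) := sign_label (below c) (vertex step b s k).
  apply: (homo_surj_ord_id (f := f)) => [i j ij|]; last exact: full.
  apply: first_true_mono => l; rewrite /below !vertex_step_inner //.
  apply: leq_ltn_trans; rewrite leq_add2l.
  by case: ltnP => // h; rewrite (leq_trans h).
have here (j : 'I_m.+1) : (b ord0 j + (s^-1%g j < j) < c)%N.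
  rewrite -vertex_step_inner //.
  apply: (@at_first_true _ (below c (vertex step b s j))).
  by have /(congr1 val) := lab_id (widen_ord (leqnSn _) j); rewrite /= => ->.
have next (j : 'I_m.+1) : (c <= b ord0 j + (s^-1%g j < j.+1))%N.
  rewrite leqNgt -vertex_step_inner //.
  apply: (@before_first_true _ (below c (vertex step b s j.+1))).
  by have /(congr1 val) := lab_id (lift ord0 j); rewrite /= /bump add1n => ->.
have sj (j : 'I_m.+1) : s^-1%g j = j /\ (b ord0 j).+1 = c.
  have := here j; have := next j; case: (ltngtP (s^-1%g j) j) => [h|h|h].
  - rewrite ltnS (ltnW h); lia.
  - rewrite [(_ < j.+1)%N]leqNgt ltnS h; lia.
  - rewrite h ltnSn; split; [exact/val_inj|lia].
split=> [|j]; last by have [] := sj j.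
apply/permP => j; rewrite perm1 -[in LHS](sj j).1 permKV //.
Qed.

Lemma det_below_corner c : (c <= N)%N ->
  \det (label_mx step (sign_label (below c.+1)) (const_mx (inord c)) 1%g) = 1.
Proof.
move=> cN; rewrite -[RHS](det1 _ m.+2); congr (\det _).
apply/matrixP => k l; rewrite !mxE; congr (_ == _)%:R.
have vE (j : 'I_m.+1) : (vertex step (const_mx (inord c)) 1%g k : pt) ord0 j
    = (c + (j < k))%N :> nat.
  have cE : (inord c : 'I_N.+2) = c :> nat by rewrite inordK // ltnS ltnW.
  by rewrite vertex_step_inner mxE cE // invg1 perm1.
apply: first_true_unique => j jk; rewrite /below vE jk.
  by rewrite addn1 ltnn.
by rewrite ltnn addn0.
Qed.

Lemma sum_inner_det_below c : (c <= N)%N ->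
  \sum_(b : pt | [forall j, (b ord0 j <= N)%N]) \sum_s
    \det (label_mx step (sign_label (below c.+1)) b s) = 1.
Proof.
move=> cN.
have cE : (inord c : 'I_N.+2) = c :> nat by rewrite inordK // ltnS ltnW.
have full0 b s : [forall j, (b ord0 j <= N)%N] ->
    (b, s) != (const_mx (inord c), 1%g) ->
    \det (label_mx step (sign_label (below c.+1)) b s) = 0.
  move=> /forallP bN bs; apply/eqP; apply: contraNT bs => /label_mx_full full.
  have [-> bc] := below_full_unique bN full; rewrite xpair_eqE eqxx andbT.
  by apply/eqP/rowP => j; apply/val_inj; rewrite /= mxE cE; have [] := bc j.
rewrite (bigD1 (const_mx (inord c))) /=; last first.
  by apply/forallP => j; rewrite mxE cE.
rewrite [X in _ + X]big1 ?addr0 => [|b /andP[bN bc]]; last first.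
  by apply: big1 => s _; rewrite full0 // xpair_eqE negb_and bc.
rewrite (bigD1 1%g) //= det_below_corner // big1 ?addr0 // => s s1.
rewrite full0 ?xpair_eqE ?negb_and ?s1 ?orbT //.
by apply/forallP => j; rewrite mxE cE.
Qed.

(** The sum of the determinants over the whole torus is 0 for [neg] as for the
    reference pattern [below c.+1].  The two patterns coincide on simplices that
    cross the seam, so the sums over the inner simplices are equal, and this sum
    is 1 for the reference pattern.  A full simplex has a vertex labelled
    [ord_max], where nothing is negative, and a vertex labelled [j] for each
    coordinate [j]. *)
Theorem cubical_sperner (c : nat) (neg : pt -> pred 'I_m.+1) : (c <= N)%N ->
  (forall x i j, (x ord0 i = 0 :> nat) \/ (x ord0 i = N.+1 :> nat) ->
     neg x j = (x ord0 j < c.+1)%N) ->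
  exists2 x, forall j, ~~ neg x j &
    forall j, exists2 y, neg y j &
      forall i, (x ord0 i <= (y ord0 i).+1)%N && (y ord0 i <= (x ord0 i).+1)%N.
Proof.
move=> cN seam.
pose D lab b := \sum_s \det (label_mx step lab b s).
pose inner b := [forall j, (b ord0 j <= N)%N].
have D0 lab : \sum_(b | inner b) D lab b = \sum_(b | ~~ inner b) D lab b.
  have := sum_det_label_mx step lab; rewrite (bigID inner) /= => /eqP.
  by rewrite addr_eq0 oppr_F2 => /eqP.
have outer b : ~~ inner b ->
    D (sign_label neg) b = D (sign_label (below c.+1)) b.
  rewrite negb_forall => /existsP[i bi]; apply: eq_bigr => s _; congr (\det _).
  apply/matrixP => k l; rewrite !mxE; congr (_ == _)%:R.
  apply/val_inj; rewrite /= !first_trueE; apply: eq_find => j.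
  by apply: (seam _ i); case: (vertex_step_outer s k bi); [right|left].
have : \sum_(b | inner b) D (sign_label neg) b = 1.
  by rewrite D0 (eq_bigr _ outer) -D0 sum_inner_det_below.
have [/existsP[[b s] /andP[/= /forallP bN d0]] _|/existsPn noF] :=
  boolP [exists bs : pt * 'S_m.+1, inner bs.1 &&
    (\det (label_mx step (sign_label neg) bs.1 bs.2) != 0)]; last first.
  rewrite big1 => [/eqP|b bin]; first by rewrite eq_sym oner_eq0.
  by apply: big1 => s _; have := noF (b, s); rewrite /= bin => /negPn/eqP.
have full := label_mx_full d0.
have [k kl] := full ord_max; exists (vertex step b s k) => [j|j].
  by apply: before_first_true; rewrite [first_true _]kl ltn_ord.
have [l ll] := full (widen_ord (leqnSn _) j); exists (vertex step b s l).
  by apply: at_first_true; rewrite [first_true _]ll.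
move=> i; rewrite !vertex_step_inner //.
by case: (_ < k)%N; case: (_ < l)%N; lia.
Qed.

End Grid.

(** * Zeros of perturbations of the identity *)

Lemma rV_norm_le (R : realType) n (u : 'rV[R]_n) r : 0 <= r ->
  (`|u| <= r) <-> (forall j, `|u ord0 j| <= r).
Proof.
move=> r0; rewrite [`|u|]mx_normrE; split=> [/bigmax_leP[_ ur] j|ur].
  exact: (ur (ord0, j)).
by apply/bigmax_leP; split=> // -[i j] _; rewrite (ord1 i).
Qed.

Section Zero.
Variables (R : realType) (m : nat).
Local Notation V := 'rV[R]_m.+1.
Implicit Types (f : V -> V) (r : R).

(** The torus with [2 * k.+1 + 1] points in each direction is mapped onto the
    ball of radius [r] of the sup norm, its seam onto the sphere. *)
Definition grid_point r k (x : 'rV['I_(k.*2.+1).+2]_m.+1) : V :=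
  \row_j (((x ord0 j)%:R - k.+1%:R) * (r / k.+1%:R)).

Lemma grid_point_norm r k x : 0 <= r -> `|@grid_point r k x| <= r.
Proof.
move=> r0; apply/rV_norm_le => // j; rewrite mxE.
have k0 : (0 : R) < k.+1%:R by rewrite ltr0n.
rewrite normrM (ger0_norm (divr_ge0 r0 (ltW k0))) mulrCA ler_piMr //.
rewrite ler_pdivrMr // mul1r ler_norml lerBrDr addNr ler0n /= lerBlDr.
by rewrite -natrD ler_nat; have := ltn_ord (x ord0 j); lia.
Qed.

(** The pattern of negative coordinates of [f] on the grid is, on the seam, that
    of the identity. *)
Lemma sphere_sign_change f r k : 0 < r -> (forall u, `|u| = r -> f u = u) ->
  exists2 u : V, `|u| <= r /\ (forall j, 0 <= f u ord0 j) &
    forall j, exists2 v, `|u - v| <= r / k.+1%:R & f v ord0 j < 0.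
Proof.
move=> r0 fid.
have d0 : 0 < r / k.+1%:R by rewrite divr_gt0 // ltr0n.
pose neg x j := f (@grid_point r k x) ord0 j < 0.
have kN : (k <= k.*2.+1)%N by lia.
have [x i j xi|x xpos xneg] := @cubical_sperner m k.*2.+1 k neg kN.
  rewrite /neg fid; first by rewrite mxE pmulr_llt0 // subr_lt0 ltr_nat.
  apply/eqP; rewrite eq_le grid_point_norm ?(ltW r0) //=.
  apply: (le_trans _ (_ : `|grid_point r x ord0 i| <= _)); last first.
    exact: ((rV_norm_le _ (normr_ge0 _)).1 (lexx _)).
  rewrite mxE normrM (gtr0_norm d0).
  have -> : `|(x ord0 i)%:R - k.+1%:R| = k.+1%:R :> R.
    case: xi => ->; first by rewrite sub0r normrN normr_nat.
    rewrite (_ : k.*2.+2 = k.+1 + k.+1)%N; last by lia.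
    by rewrite natrD addrK normr_nat.
  by rewrite mulrC divfK // pnatr_eq0.
exists (grid_point r x) => [|j].
  split=> [|j]; first exact/grid_point_norm/ltW.
  by have := xpos j; rewrite -leNgt.
have [y yneg xy] := xneg j; exists (grid_point r y) => //.
apply/rV_norm_le => [|i]; first exact: ltW.
rewrite !mxE -mulrBl normrM (gtr0_norm d0) ler_piMl ?(ltW d0) //.
rewrite opprB addrA subrK ler_norml.
by have := xy i; rewrite -!(ler_nat R) -!natr1; lra.
Qed.

(** At a cluster point of the points of [sphere_sign_change], a coordinate of
    [f] can be neither negative, as it is nonnegative at these points, nor
    positive, as it is negative arbitrarily close to them. *)
Lemma zero_of_identity_on_sphere f r : 0 < r ->
  (forall u, `|u| <= r -> {for u, continuous f}) ->
  (forall u, `|u| = r -> f u = u) ->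
  exists2 u, `|u| <= r & f u = 0.
Proof.
move=> r0 fc fid.
have /choice[u_ u_P] k : exists u : V,
    [/\ `|u| <= r, forall j, 0 <= f u ord0 j &
    forall j, exists2 v, `|u - v| <= r / k.+1%:R & f v ord0 j < 0].
  by have [u [ur fu] uv] := sphere_sign_change k r0 fid; exists u.
have ball_compact : compact [set u : V | `|u| <= r].
  apply: bounded_closed_compact.
    exists r; split=> [|x rx u /= /le_trans->//]; first exact: num_real.
    exact: ltW.
  apply: (closed_comp (f := fun u : V => `|u|) (D := [set x | x <= r])).
    by move=> u _; exact: norm_continuous.
  exact: closed_le.
have u_ball : \forall k \near \oo, `|u_ k| <= r.
  by apply: nearW => k; have [] := u_P k.
have [u [/= ur ucl]] := ball_compact (u_ @ \oo) _ u_ball.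
have coordc j : {for u, continuous (fun v => f v ord0 j)}.
  apply: (@continuous_comp _ _ _ f (fun M : V => M ord0 j)); first exact: fc.
  exact: coord_continuous.
exists u => //; apply/rowP => j; rewrite mxE.
apply: le_anti; apply/andP; split; rewrite leNgt; apply/negP => fuj.
- have /nbhs_ballP[e /= e0 eball] : nbhs u [set v | 0 < f v ord0 j].
    exact: cvgr_gt (coordc j) _ fuj.
  have u_mesh : \forall k \near \oo,
      exists2 l, r / l.+1%:R < e / 2 & u_ k = u_ l.
    have : \forall k \near \oo, k.+1%:R^-1 < e / 2 / r.
      have er : 0 < e / 2 / r by rewrite !divr_gt0.
      exact: (near_infty_natSinv_lt (PosNum er)).
    by apply: filterS => k ke; exists k => //; rewrite mulrC -ltr_pdivlMr.
  have [v [/= [k ke ->] uk]] := ucl [set v |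
    exists2 l, r / l.+1%:R < e / 2 & v = u_ l] (ball u (e / 2)) u_mesh
    (nbhsx_ballx _ _ (divr_gt0 e0 (ltr0n _ 2))).
  have [_ _ /(_ j)[w uw]] := u_P k; apply/negP; rewrite -leNgt ltW //.
  apply: eball; rewrite /= (splitr e); apply: ball_triangle uk _.
  by rewrite -ball_normE /=; exact: le_lt_trans ke.
- have fun0 : nbhs u [set v | f v ord0 j < 0].
    exact: cvgr_lt (coordc j) _ fuj.
  have u_pos : \forall k \near \oo, 0 <= f (u_ k) ord0 j.
    by apply: nearW => k; have [_ /(_ j)] := u_P k.
  have [v [/= + fv]] := ucl [set v | 0 <= f v ord0 j] _ u_pos fun0.
  by rewrite leNgt fv.
Qed.

(** The perturbation is damped so as to vanish on the sphere, without changing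
    [f] on the ball of radius [r / 2], which contains every zero of the damped
    map. *)
Theorem near_identity_zero f r : 0 < r ->
  (forall u, `|u| <= r -> {for u, continuous f}) ->
  (forall u, `|u| <= r -> `|f u - u| <= r / 2) ->
  exists2 u, `|u| <= r & f u = 0.
Proof.
move=> r0 fc fnear.
pose chi (u : V) : R := Num.min 1 (2 - 2 * (`|u| / r)).
have chi1 u : `|u| <= r / 2 -> chi u = 1.
  move=> ur; apply/min_idPl.
  have : `|u| / r <= 1 / 2 by rewrite ler_pdivrMr //; lra.
  lra.
have chic : continuous chi.
  move=> u; apply: (@continuous_min R V (cst 1) (fun u => 2 - 2 * (`|u| / r))).
    exact: cst_continuous.
  apply: continuousB; first exact: cst_continuous.
  apply: continuousM; first exact: cst_continuous.
  by apply: continuousM; [exact: norm_continuous|exact: cst_continuous].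
have gc (u : V) : `|u| <= r ->
    {for u, continuous (fun v : V => v + chi v *: (f v - v))}.
  move=> ur; apply: continuousD; first exact: cvg_id.
  apply: continuousZ; first exact: chic.
  by apply: continuousB; [exact: fc|exact: cvg_id].
have gid (u : V) : `|u| = r -> u + chi u *: (f u - u) = u.
  move=> ur; rewrite (_ : chi u = 0) ?scale0r ?addr0 //.
  by rewrite /chi ur divff ?gt_eqF // mulr1 subrr; apply/min_idPr.
have [u ur /eqP] := zero_of_identity_on_sphere r0 gc gid.
rewrite addr_eq0 => /eqP uE.
have chi01 : 0 <= chi u <= 1.
  rewrite ge_min lexx /= andbT le_min ler01 /=.
  have : `|u| / r <= 1 by rewrite ler_pdivrMr // mul1r.
  lra.
have u2 : `|u| <= r / 2.
  case/andP: chi01 => c0 c1.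
  rewrite uE normrN normrZ ger0_norm //; apply: le_trans (fnear u ur).
  by rewrite ler_piMl.
exists u => //; move/eqP: uE; rewrite chi1 // scale1r opprB -subr_eq0.
by rewrite opprB addrC subrK => /eqP.
Qed.

End Zero.

(** * Linear alternatives *)

(** Induction on the number of forms.  Let [a x] be the new form, nonzero, and
    [u] such that [a x u = 1].  The forms [a i - a i u * a x] vanish at [u] and
    agree with [a i] on the kernel of [a x].  If they are simultaneously
    positive at some [v], the point [v - a x v *: u], slightly moved along
    [u], works for all the forms.  Otherwise a nontrivial nonnegative
    combination of the [a i] equals [c * a x] for a scalar [c].  When [c <= 0]
    this is the desired relation; when [c > 0], any point where all the
    [a i] are positive is one where [a x] is positive too, and the induction
    hypothesis applies to the [a i] themselves. *)
Lemma gordan (R : realFieldType) (V : lmodType R) (T : eqType)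
    (a : T -> V -> R) (s : seq T) :
  (forall i, scalar (a i)) -> uniq s ->
  (exists v, forall i, i \in s -> 0 < a i v) \/
  (exists l : T -> R, [/\ forall i, 0 <= l i, exists2 i, i \in s & l i != 0
     & forall v, \sum_(i <- s) l i * a i v = 0]).
Proof.
elim: s a => [|x s IH] a a_lin /=; first by left; exists 0.
move=> /andP[xs us].
have aB i v c u : a i (v + c *: u) = a i v + c * a i u.
  by rewrite addrC a_lin addrC.
have notx i : i \in s -> (i == x) = false.
  by move=> is_; apply: contraNF xs => /eqP <-.
have sum_upd l c v :
    \sum_(i <- x :: s) (if i == x then c else l i) * a i v =
    c * a x v + \sum_(i <- s) l i * a i v.
  rewrite big_cons eqxx; congr (_ + _).
  by apply: eq_big_seq => i /notx ->.
have ext (l : T -> R) c : 0 <= c -> (forall i, 0 <= l i) ->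
    (forall v, c * a x v + \sum_(i <- s) l i * a i v = 0) ->
    c != 0 \/ (exists2 i, i \in s & l i != 0) ->
    exists l : T -> R, [/\ forall i, 0 <= l i,
       exists2 i, i \in x :: s & l i != 0
     & forall v, \sum_(i <- x :: s) l i * a i v = 0].
  move=> c0 l0 l_sum lneq; exists (fun i => if i == x then c else l i); split.
  - by move=> i; case: ifP.
  - case: lneq => [cn|[i is_ li]]; first by exists x; rewrite ?mem_head // eqxx.
    by exists i; rewrite ?notx // inE is_ orbT.
  - by move=> v; rewrite sum_upd.
have [[u0 u0_neq]|ax0] := pselect (exists u, a x u != 0); last first.
  right; apply: (ext (fun=> 0) 1) => // [v|]; last by left; rewrite oner_eq0.
  rewrite mul1r big1 ?addr0 => [|i _]; last by rewrite mul0r.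
  by apply/eqP/negPn/negP => av; apply: ax0; exists v.
have a0 i : a i 0 = 0 by have := aB i 0 (-1) 0; rewrite scaler0 addr0; lra.
have aZ i c u : a i (c *: u) = c * a i u by rewrite -[c *: u]add0r aB a0 add0r.
pose u := (a x u0)^-1 *: u0.
have axu : a x u = 1 by rewrite aZ mulVf.
have b_lin i : scalar (fun v => a i v - a i u * a x v).
  by move=> c v w; rewrite !a_lin; ring.
have [[v vb]|[l [l0 [k ks lk] l_sum]]] := IH _ b_lin us.
  left; pose w := v + (- a x v) *: u.
  have axw : a x w = 0 by rewrite aB axu; ring.
  have aw i : i \in s -> 0 < a i w by move=> /vb; rewrite aB; lra.
  (* The step along u is short enough to change each a i w by less than
     itself. *)
  pose S := \sum_(i <- s) `|a i u| / `|a i w|.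
  have S0 : 0 <= S by apply: sumr_ge0 => i _; rewrite divr_ge0.
  have S1 : 0 < (1 + S)^-1 by rewrite invr_gt0 ltr_pwDl.
  exists (w + (1 + S)^-1 *: u) => i; rewrite inE aB => /predU1P[->|is_].
    by rewrite axw axu mulr1 add0r.
  have auS : `|a i u| <= S * a i w.
    rewrite -ler_pdivrMr ?aw // -[in X in X <= _](gtr0_norm (aw i is_)).
    rewrite /S (big_rem i) //= lerDl.
    by apply: sumr_ge0 => j _; rewrite divr_ge0.
  rewrite mulrC addrC -ltrBlDr sub0r ltr_pdivlMr ?ltr_pwDl //.
  have := ler_norm (- a i u); rewrite normrN; have := aw i is_.
  nra.
have l_sumE v : \sum_(i <- s) l i * a i v = (\sum_(i <- s) l i * a i u) * a x v.
  apply/eqP; rewrite -subr_eq0 mulr_suml -sumrB; apply/eqP.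
  by rewrite -[RHS](l_sum v); apply: eq_bigr => i _; rewrite mulrBr mulrA.
have [c0|c0] := leP (\sum_(i <- s) l i * a i u) 0.
  right; apply: (ext l (- \sum_(i <- s) l i * a i u)) => //.
  - by rewrite oppr_ge0.
  - by move=> v; rewrite (l_sumE v) mulNr addNr.
  - by right; exists k.
have [[v va]|[l' [l'0 l'n l'_sum]]] := IH a a_lin us; last first.
  right; apply: (ext l' 0) => // [v|]; first by rewrite mul0r add0r.
  by right.
left; exists v => j; rewrite inE => /predU1P[->|]; last exact: va.
rewrite -(pmulr_rgt0 _ c0) -l_sumE (big_rem k) //= ltr_pwDl //.
  by rewrite mulr_gt0 ?va // lt_neqAle eq_sym lk l0.
rewrite big_seq; apply: sumr_ge0 => i /mem_rem is_.
by rewrite mulr_ge0 // ltW // va.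
Qed.

Lemma scalar_sum_delta (F : comNzRingType) n (d : 'rV[F]_n -> F) :
  scalar d -> forall v, d v = \sum_i v ord0 i * d (delta_mx ord0 i).
Proof.
move=> d_lin v; have d0 : d 0 = 0.
  by have := d_lin (-1) 0 0; rewrite scaler0 addr0 mulN1r addNr.
rewrite [in LHS](row_sum_delta v).
elim/big_rec2: _ => [//|i x y _ <-]; exact: d_lin.
Qed.

(** The forms are the columns of a matrix, which either has a full row space, or
    has a nontrivial relation between its columns. *)
Lemma forms_dependent_or_right_inverse (F : fieldType) n q
    (d : 'I_q -> 'rV[F]_n -> F) : (forall j, scalar (d j)) ->
  (exists2 mu : 'I_q -> F, exists j, mu j != 0 &
      forall v, \sum_j mu j * d j v = 0) \/
  (exists L : 'M[F]_(q, n), forall w j, d j (w *m L) = w ord0 j).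
Proof.
move=> d_lin; pose J : 'M[F]_(n, q) := \matrix_(i, j) d j (delta_mx ord0 i).
have dJ j v : d j v = (v *m J) ord0 j.
  rewrite mxE (scalar_sum_delta (d_lin j)).
  by under [RHS]eq_bigr do rewrite mxE.
have [/row_fullP[L LJ]|Jnfull] := boolP (row_full J).
  by right; exists L => w j; rewrite dJ -mulmxA LJ mulmx1.
left; have : kermx J^T != 0.
  by rewrite kermx_eq0 /row_free mxrank_tr -/(row_full J).
move=> /rowV0Pn[u /sub_kermxP uJ /rV0Pn[j uj]]; exists (u ord0).
  by exists j.
move=> v; have : (v *m J *m u^T) ord0 ord0 = 0.
  by rewrite -mulmxA -[J]trmxK -trmx_mul uJ trmx0 mulmx0 mxE.
rewrite mxE => uvJ; rewrite -[RHS]uvJ.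
by apply: eq_bigr => k _; rewrite dJ mulrC [u^T _ _]mxE.
Qed.

(** * Directions along which a property persists *)

Section Directions.
Variables (R : realType) (n : nat).
Local Notation V := 'rV[R]_n.
Implicit Types (f : V -> R) (x v : V).

Lemma diff_scalar f x : scalar ('d f x).
Proof. by move=> c u v; rewrite linearP. Qed.

(** The remainder is uniform over bounded directions; this is what Frechet
    differentiability adds to Gateaux differentiability. *)
Lemma differentiable_uniform_remainder f x (C e : R) :
  differentiable f x -> 0 < C -> 0 < e ->
  \forall t \near 0^'+, forall v, `|v| <= C ->
    `|f (x + t *: v) - f x - t * 'd f x v| <= e * t.
Proof.
move=> df C0 e0; have eC : 0 < e / C by rewrite divr_gt0.
have [r r0 rP] : exists2 r, 0 < r & forall h : V, `|h| < r ->
    `|f (x + h) - f x - 'd f x h| <= e / C * `|h|.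
  have /eqaddoP/(_ _ eC)/nbhs_norm0P[r /= r0 rP] := diff_locally df.
  exists r => // h /rP /=; rewrite !fctE /= [h + x]addrC.
  by rewrite opprD addrA.
near=> t => v vC; have t0 : 0 < t by near: t; exact: nbhs_right_gt.
have tvC : `|t *: v| <= t * C by rewrite normrZ gtr0_norm // ler_wpM2l // ltW.
have tr : `|t *: v| < r.
  apply: le_lt_trans tvC _; rewrite -ltr_pdivlMr //.
  by near: t; apply: nbhs_right_lt; rewrite divr_gt0.
have := rP _ tr; rewrite linearZ; move/le_trans; apply.
rewrite (le_trans (ler_wpM2l (ltW eC) tvC)) //.
by rewrite mulrCA divfK ?gt_eqF // mulrC.
Unshelve. all: by end_near. Qed.

Lemma nbhs_direction (A : set V) x v : nbhs x A ->
  \forall v' \near v & t \near (0 : R)^'+, A (x + t *: v').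
Proof.
pose F := filter_prod (nbhs v) ((0 : R)^'+).
have FF : Filter F by exact: filter_prod_filter.
have Fv : (fun p : V * R => p.1) @ F --> v by exact: cvg_fst.
have F0 : (fun p : V * R => p.2) @ F --> (0 : R).
  by apply: cvg_trans cvg_snd _; exact: cvg_within.
have : (fun p : V * R => x + p.2 *: p.1) @ F --> x + (0 : R) *: v.
  by apply: cvgD; [exact: cvg_cst|exact: cvgZ].
by rewrite scale0r addr0 => + xA => /(_ A xA).
Qed.

(** The derivative stays above half its value at [v] near [v], and the remainder
    is taken below a quarter of it. *)
Lemma ascent_direction f x v : differentiable f x -> 0 < 'd f x v ->
  \forall v' \near v & t \near (0 : R)^'+, f x < f (x + t *: v').
Proof.
move=> df dv.
have e0 : 0 < 'd f x v / 4 by rewrite divr_gt0.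
have C0 : 0 < `|v| + 1 by rewrite ltr_wpDl.
exists ([set v' : V | 'd f x v / 2 < 'd f x v' /\ `|v'| <= `|v| + 1],
  [set t : R | 0 < t /\ forall v', `|v'| <= `|v| + 1 ->
    `|f (x + t *: v') - f x - t * 'd f x v'| <= 'd f x v / 4 * t]).
  split=> /=.
    apply: filterI.
      have dv2 : 'd f x v / 2 < 'd f x v by lra.
      exact: cvgr_gt (@diff_continuous _ _ _ _ _ df v) _ dv2.
    have vv1 : `|v| < `|v| + 1 by rewrite ltrDl.
    exact: (@cvgr_norm_le _ _ _ (nbhs v) _ id v cvg_id _ vv1).
  apply: filterI; first exact: nbhs_right_gt.
  exact: differentiable_uniform_remainder.
move=> [v' t] /= [[dv' v'C] [t0 /(_ _ v'C)]].
by rewrite ler_norml => /andP[+ _]; nra.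
Qed.

End Directions.

(** * The zero set of the equality constraints *)

Lemma continuous_rV (R : realType) (T : topologicalType) n
    (f : T -> 'rV[R]_n) x :
  (forall j, {for x, continuous (fun y => f y ord0 j)}) ->
  {for x, continuous f}.
Proof.
move=> fc; apply/cvgrPdist_le => e e0.
have : \forall y \near x, forall j, `|f x ord0 j - f y ord0 j| <= e.
  apply: filter_forall => j; move: e e0; apply/cvgrPdist_le; exact: fc.
apply: filterS => y fxy; apply/rV_norm_le => [|j]; first exact: ltW.
by rewrite !mxE.
Qed.

Lemma mulmx_bounded (R : realType) q n (L : 'M[R]_(q, n)) :
  exists2 K : R, 0 < K & forall w : 'rV_q, `|w *m L| <= K * `|w|.
Proof.
exists (1 + \sum_i \sum_j `|L i j|).
  by rewrite ltr_pwDl // sumr_ge0 // => i _; exact: sumr_ge0.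
move=> w; apply/rV_norm_le => [|j].
  by rewrite mulr_ge0 // addr_ge0 // sumr_ge0 // => i _; exact: sumr_ge0.
rewrite mxE (le_trans (ler_norm_sum _ _ _)) // mulrDl mul1r ler_wpDl //.
rewrite mulr_suml; apply: ler_sum => i _; rewrite normrM mulrC.
apply: ler_pM => //; last exact: ((rV_norm_le _ (normr_ge0 _)).1 (lexx _)).
by rewrite (bigD1 j) //= lerDl sumr_ge0.
Qed.

Lemma mulmxr_continuous (R : realType) q n (L : 'M[R]_(q, n)) :
  continuous (fun w : 'rV[R]_q => w *m L).
Proof.
apply: (@bounded_linear_continuous R 'rV[R]_q 'rV[R]_n (mulmxr L)).
apply/linear_boundedP; have [K K0 LK] := mulmx_bounded L.
near=> r => w; rewrite (le_trans (LK w)) // ler_wpM2r //.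
Unshelve. all: by end_near. Qed.

(** The map [f] that sends [w] to [t^-1 *: h (x + t *: (v + w *m L))] differs
    from the identity by the remainders of the [h j], divided by [t]: for small
    [t] it falls under [near_identity_zero] on the ball of radius [r / K], whose
    image under [L] lies in the ball of radius [r]. *)
Lemma zero_set_tangent (R : realType) n m (h : 'I_m.+1 -> 'rV[R]_n -> R)
    (x v : 'rV[R]_n) (L : 'M[R]_(m.+1, n)) (r : R) :
  (forall j, h j x = 0) ->
  (forall j, \forall y \near x, {for y, continuous (h j)}) ->
  (forall j, differentiable (h j) x) ->
  (forall w j, 'd (h j) x (w *m L) = w ord0 j) ->
  (forall j, 'd (h j) x v = 0) -> 0 < r ->
  \forall t \near (0 : R)^'+, exists2 v' : 'rV_n, `|v' - v| <= r &
    forall j, h j (x + t *: v') = 0.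
Proof.
move=> hx0 hc hd dL dv r0; have [K K0 LK] := mulmx_bounded L.
pose s := r / K; have s0 : 0 < s by rewrite divr_gt0.
have wr (w : 'rV[R]_m.+1) : `|w| <= s -> `|w *m L| <= r.
  by move=> ws; rewrite (le_trans (LK w)) // mulrC -ler_pdivlMr.
have wC (w : 'rV[R]_m.+1) : `|w| <= s -> `|v + w *m L| <= `|v| + r.
  by move=> ws; rewrite (le_trans (ler_normD _ _)) // lerD2l wr.
have C0 : 0 < `|v| + r by rewrite ltr_wpDl.
have /nbhs_ballP[e /= e0 eball] :
    nbhs x [set y | forall j, {for y, continuous (h j)}].
  exact: (filter_forall _ hc).
have s20 : 0 < s / 2 by rewrite divr_gt0.
near=> t; have t0 : 0 < t by near: t; exact: nbhs_right_gt.
pose f (w : 'rV[R]_m.+1) : 'rV[R]_m.+1 :=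
  \row_j (t^-1 * h j (x + t *: (v + w *m L))).
have fc (w : 'rV[R]_m.+1) : `|w| <= s -> {for w, continuous f}.
  move=> ws; apply: continuous_rV => j.
  rewrite (_ : (fun y => _) =
    (fun y => t^-1 * (h j \o (fun w' => x + t *: (v + w' *m L))) y)).
    2: by apply/funext => y; rewrite mxE.
  apply: continuousM; first exact: cst_continuous.
  apply: continuous_comp.
    apply: continuousD; first exact: cst_continuous.
    apply: continuousZ; first exact: cst_continuous.
    by apply: continuousD; [exact: cst_continuous|exact: mulmxr_continuous].
  apply: eball; rewrite -ball_normE /= opprD addNKr normrN normrZ gtr0_norm //.
  rewrite (le_lt_trans (ler_wpM2l (ltW t0) (wC w ws))) // -ltr_pdivlMr //.
  by near: t; apply: nbhs_right_lt; rewrite divr_gt0.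
have fnear (w : 'rV[R]_m.+1) : `|w| <= s -> `|f w - w| <= s / 2.
  move=> ws; apply/rV_norm_le => [|j]; first by rewrite divr_ge0 ?ltW.
  have hrem : forall j (v' : 'rV_n), `|v'| <= `|v| + r ->
      `|h j (x + t *: v') - h j x - t * 'd (h j) x v'| <= s / 2 * t.
    near: t; apply: filter_forall => l.
    exact: differentiable_uniform_remainder (hd l) C0 s20.
  have := hrem j _ (wC w ws); rewrite hx0 subr0.
  have -> : 'd (h j) x (v + w *m L) = w ord0 j.
    by rewrite linearD /= dv add0r dL.
  move=> hw.
  rewrite !mxE -(ler_pM2r t0) -[X in _ * X <= _](gtr0_norm t0) -normrM.
  by rewrite mulrBl mulrAC mulVf ?gt_eqF // mul1r [w _ _ * t]mulrC.
have [w ws fw0] := near_identity_zero s0 fc fnear.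
exists (v + w *m L) => [|j]; first by rewrite addrC addKr wr.
move/rowP/(_ j): fw0; rewrite !mxE => /eqP.
by rewrite mulf_eq0 invr_eq0 gt_eqF //= => /eqP.
Unshelve. all: by end_near. Qed.

(** * Multipliers *)

Lemma no_ascent_direction (R : realType) (n p m : nat) (Omega : set 'rV[R]_n)
    (phi : 'rV[R]_n -> R) (g : 'I_p -> 'rV[R]_n -> R)
    (h : 'I_m.+1 -> 'rV[R]_n -> R) (x v : 'rV[R]_n) (L : 'M[R]_(m.+1, n)) :
  open Omega -> is_solution Omega phi g h x ->
  differentiable phi x ->
  (forall i, g i x = 0 -> differentiable (g i) x) ->
  (forall i, 0 < g i x -> lower_semicontinuous_at (g i) x) ->
  (forall j, (\forall y \near x, {for y, continuous (h j)}) /\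
     differentiable (h j) x) ->
  (forall w j, 'd (h j) x (w *m L) = w ord0 j) ->
  (forall j, 'd (h j) x v = 0) ->
  0 < 'd phi x v ->
  ~ (forall i, g i x = 0 -> 0 < 'd (g i) x v).
Proof.
move=> Oopen [[Ox gx hx] xmax] dphi dg lscg hcd dL dv phiv gv.
have gpos i : \forall v' \near v & t \near (0 : R)^'+, 0 < g i (x + t *: v').
  have [gi0|gi0] := eqVneq (g i x) 0.
    by have := ascent_direction (dg i gi0) (gv i gi0); rewrite gi0.
  apply: (@nbhs_direction _ _ [set y | 0 < g i y]).
  by apply: lscg; rewrite lt_neqAle eq_sym gi0 gx.
have gpos_all : \forall v' \near v & t \near (0 : R)^'+,
    forall i, 0 < g i (x + t *: v').
  exact: (filter_forall _ gpos).
have phi_up := ascent_direction dphi phiv.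
have Omega_dir := nbhs_direction v (open_nbhs_nbhs (conj Oopen Ox)).
have [[U T] /= [/nbhs_ballP[e /= e0 eU] nT] UT] :=
  filterI Omega_dir (filterI phi_up gpos_all).
have e20 : 0 < e / 2 by rewrite divr_gt0.
have tang := zero_set_tangent hx (fun j => (hcd j).1) (fun j => (hcd j).2)
  dL dv e20.
have [t [Tt [v' v'v hv']]] := filter_ex (filterI nT tang).
have Uv' : U v'.
  apply: eU; rewrite -ball_normE /= distrC; apply: (le_lt_trans v'v); lra.
have [Ov' [phiv' gv']] := UT (v', t) (conj Uv' Tt).
suff : phi (x + t *: v') <= phi x by rewrite leNgt phiv'.
by apply: xmax; split=> // i; exact: ltW.
Qed.

(** Gordan's alternative is used for the forms [D o \o pr], where [pr] projects
    onto the common kernel of the differentials of the [h j]; by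
    [no_ascent_direction] it yields a relation.  A form [alpha] that vanishes on
    the range of [pr] is determined by its values on the rows of [L], and these
    are, up to sign, the multipliers [mu]. *)
Lemma FJ_multipliers_of_right_inverse (R : realType) (n p m : nat)
    (Omega : set 'rV[R]_n)
    (phi : 'rV[R]_n -> R) (g : 'I_p -> 'rV[R]_n -> R)
    (h : 'I_m.+1 -> 'rV[R]_n -> R) (x : 'rV[R]_n) (L : 'M[R]_(m.+1, n)) :
  open Omega -> is_solution Omega phi g h x ->
  differentiable phi x ->
  (forall i, g i x = 0 -> differentiable (g i) x) ->
  (forall i, 0 < g i x -> lower_semicontinuous_at (g i) x) ->
  (forall j, (\forall y \near x, {for y, continuous (h j)}) /\
     differentiable (h j) x) ->
  (forall w j, 'd (h j) x (w *m L) = w ord0 j) ->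
  exists (lambda0 : R) (lambda : 'I_p -> R) (mu : 'I_m.+1 -> R),
    FJ_multipliers phi g h x lambda0 lambda mu /\
    ~ (lambda0 = 0 /\ (forall i, lambda i = 0)).
Proof.
move=> Oopen sol dphi dg lscg hcd dL.
(* None stands for phi, and Some i for g i. *)
pose D (o : option 'I_p) :=
  if o is Some i then 'd (g i) x : 'rV[R]_n -> R else 'd phi x.
have D_lin o : scalar (D o) by case: o => [i|]; exact: diff_scalar.
pose pr (v : 'rV[R]_n) := v - (\row_j 'd (h j) x v) *m L.
have pr_lin c u v : pr (c *: u + v) = c *: pr u + pr v.
  rewrite /pr scalerBr addrACA -opprD scalemxAl -mulmxDl; congr (_ - _ *m _).
  by apply/rowP => j; rewrite !mxE diff_scalar.
have prh v j : 'd (h j) x (pr v) = 0.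
  by rewrite linearB /= dL mxE subrr.
pose s : seq (option 'I_p) :=
  None :: [seq Some i | i <- enum 'I_p & g i x == 0].
have us : uniq s.
  rewrite /= (map_inj_uniq Some_inj) filter_uniq ?enum_uniq // andbT.
  by apply/mapP => -[].
have in_s i : (Some i \in s) = (g i x == 0).
  by rewrite inE /= (mem_map Some_inj) mem_filter mem_enum andbT.
have Dpr_lin o : scalar (fun v => D o (pr v)).
  by move=> c u v; rewrite pr_lin D_lin.
have [[v vpos]|[l [l0 [k ks lk] l_sum]]] := gordan Dpr_lin us.
  exfalso; apply: (no_ascent_direction Oopen sol dphi dg lscg hcd dL (prh v)).
    by have := vpos None; rewrite inE eqxx; apply.
  by move=> i gi0; have := vpos (Some i); rewrite in_s gi0 eqxx; apply.
pose lam i := if g i x == 0 then l (Some i) else 0.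
pose alpha v := \sum_(o <- s) l o * D o v.
have alphaE v : alpha v =
    l None * 'd phi x v + \sum_(i < p) lam i * gateaux_diff (g i) x v.
  rewrite /alpha big_cons big_map big_filter big_mkcond big_enum /=.
  congr (_ + _).
  apply: eq_bigr => i _; rewrite /lam /gateaux_diff.
  by case: eqP => [/dg dgi|_]; rewrite ?mul0r // deriveE.
have alpha_lin : scalar alpha.
  move=> c u v; rewrite /alpha mulr_sumr -big_split /=; apply: eq_bigr => i _.
  by rewrite D_lin mulrDr mulrCA.
have alphaL v : alpha v = \sum_j 'd (h j) x v * alpha (delta_mx ord0 j *m L).
  have alphaL_lin : scalar (fun w => alpha (w *m L)).
    by move=> c u w; rewrite mulmxDl -scalemxAl alpha_lin.
  have vE : v = 1 *: pr v + (\row_j 'd (h j) x v) *m L.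
    by rewrite scale1r subrK.
  rewrite [in LHS]vE alpha_lin [alpha (pr v)]l_sum mulr0 add0r.
  rewrite (scalar_sum_delta alphaL_lin).
  by apply: eq_bigr => j _; rewrite mxE.
exists (l None), lam, (fun j => - alpha (delta_mx ord0 j *m L)).
have lnz : ~ (l None = 0 /\ forall i, lam i = 0).
  case=> lN0 lam0; case/eqP: lk; case: k ks => [i|_ //].
  by rewrite in_s => gi0; have := lam0 i; rewrite /lam gi0.
split=> //; split.
- by split=> // i; rewrite /lam; case: ifP.
- by case=> lN lam0 _; apply: lnz.
- by move=> i; rewrite /lam; case: eqP => [->|_]; rewrite ?mulr0 ?mul0r.
- move=> v; rewrite -alphaE alphaL -big_split big1 //= => j _.
  by rewrite mulNr mulrC subrr.
Qed.

Lemma free_diff_family_independent (R : realType) (n q : nat)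
    (h : 'I_q -> 'rV[R]_n -> R) (x : 'rV[R]_n) (mu : 'I_q -> R) :
  free (diff_family h x) -> (forall v, \sum_j mu j * 'd (h j) x v = 0) ->
  forall j, mu j = 0.
Proof.
move=> /freeP hfree mu0; apply: hfree; apply/lfunP => v.
rewrite sum_lfunE lfunE /= -[RHS](mu0 v); apply: eq_bigr => j _.
by rewrite lfunE /= (nth_map j) ?size_enum_ord // nth_ord_enum lfunE.
Qed.

Theorem theorem3p2 (R : realType) (n p q : nat)
    (hn : (1 <= n)%N) (hp : (1 <= p)%N) (hq : (1 <= q)%N)
    (Omega : set 'rV[R]_n) (Omega_neq0 : Omega !=set0) (Omega_open : open Omega)
    (phi : 'rV[R]_n -> R) (g : 'I_p -> 'rV[R]_n -> R)
    (h : 'I_q -> 'rV[R]_n -> R) (xhat : 'rV[R]_n)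
    (xhat_sol : is_solution Omega phi g h xhat)
    (Hi : differentiable phi xhat)
    (Hii : forall i, g i xhat = 0 -> differentiable (g i) xhat)
    (Hiii : forall i, 0 < g i xhat ->
       lower_semicontinuous_at (g i) xhat /\ gateaux_differentiable (g i) xhat)
    (Hiv : forall j,
       (\forall x \near xhat, {for x, continuous (h j)}) /\
       differentiable (h j) xhat) :
  [/\ exists (lambda0 : R) (lambda : 'I_p -> R) (mu : 'I_q -> R),
        FJ_multipliers phi g h xhat lambda0 lambda mu,
      free (diff_family h xhat) ->
        exists (lambda0 : R) (lambda : 'I_p -> R) (mu : 'I_q -> R),
          FJ_multipliers phi g h xhat lambda0 lambda mu /\
          ~ (lambda0 = 0 /\ (forall i, lambda i = 0))
    & free (diff_family h xhat) ->
      (exists w : 'rV[R]_n,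
         (forall j, 'd (h j) xhat w = 0) /\
         (forall i, g i xhat = 0 -> 0 < 'd (g i) xhat w)) ->
        exists (lambda0 : R) (lambda : 'I_p -> R) (mu : 'I_q -> R),
          FJ_multipliers phi g h xhat lambda0 lambda mu /\ lambda0 = 1].
Proof.
case: q hq h xhat_sol Hiv => // m _ h xhat_sol Hiv.
have lscg i : 0 < g i xhat -> lower_semicontinuous_at (g i) xhat.
  by move=> /Hiii[].
have main L := @FJ_multipliers_of_right_inverse _ _ _ _ _ _ _ _ _ L Omega_open
  xhat_sol Hi Hii lscg Hiv.
have [[mu [j muj] mu0]|[L dL]] :=
    forms_dependent_or_right_inverse (fun j => @diff_scalar _ _ (h j) xhat).
  have nfree : ~ free (diff_family h xhat).
    move=> /free_diff_family_independent/(_ mu0)/(_ j)/eqP.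
    by rewrite (negPf muj).
  split=> //; exists 0, (fun=> 0), mu; split.
  - by split.
  - by case=> _ _ /(_ j)/eqP; rewrite (negPf muj).
  - by move=> i; rewrite mul0r.
  - move=> v; rewrite mul0r add0r mu0 addr0 big1 // => i _.
    by rewrite mul0r.
have [l0 [l [mu [FJ lnz]]]] := main L dL.
split=> [|_|_ [w [hw gw]]]; [by exists l0, l, mu|by exists l0, l, mu|].
have [[l0_ge0 l_ge0] _ comp stat] := FJ.
(* If l0 = 0, evaluation at w gives a vanishing sum of nonnegative terms, in
   which each active term has a positive factor. *)
have l0_neq0 : l0 != 0.
  apply/eqP => l00; apply: lnz; split=> // i.
  have inact k : g k xhat != 0 -> l k = 0.
    by move=> gk; have /eqP := comp k; rewrite mulf_eq0 (negPf gk) orbF => /eqP.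
  have gdw k : g k xhat = 0 -> gateaux_diff (g k) xhat w = 'd (g k) xhat w.
    by move=> /Hii dgk; rewrite /gateaux_diff deriveE.
  have term k : 0 <= l k * gateaux_diff (g k) xhat w.
    have [gk|/inact->] := eqVneq (g k xhat) 0; last by rewrite mul0r.
    by rewrite gdw // mulr_ge0 // ltW // gw.
  have := stat w; rewrite l00 mul0r add0r.
  rewrite [X in _ + X]big1 => [|j _]; last by rewrite hw mulr0.
  rewrite addr0 => /psumr_eq0P/(_ i isT) li.
  have [gi|/inact//] := eqVneq (g i xhat) 0.
  have /eqP : l i * gateaux_diff (g i) xhat w = 0 by apply: li.
  by rewrite gdw // mulf_eq0 (gt_eqF (gw i gi)) orbF => /eqP.
have l0_gt0 : 0 < l0 by rewrite lt_neqAle eq_sym l0_neq0.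
exists 1, (fun i => l0^-1 * l i), (fun j => l0^-1 * mu j); split=> //; split.
- by split=> // i; rewrite mulr_ge0 // invr_ge0.
- by case=> /eqP; rewrite oner_eq0.
- by move=> i; rewrite -mulrA comp mulr0.
- move=> v; rewrite -[RHS](mulr0 l0^-1) -[in RHS](stat v) !mulrDr !mulr_sumr.
  rewrite mulrA mulVf //.
  by congr (_ + _ + _); apply: eq_bigr => i _; rewrite mulrA.
Qed.
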